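(* Let $\gamma>0$, $\beta\in\mathbb{R}$, $\Delta t>0$, let $N\ge 1$, and let $\mathbf{m}^0$ be a periodic grid function with $|\mathbf{m}^0_{\mathbf I}|=1$ for all $\mathbf I$. Let $\{\mathbf{m}^n,\widetilde{\mathbf{m}}^n\}_{1\le n\le N}$ be the solution of the fully discrete scheme $$\frac{\widetilde{\mathbf{m}}^n-\mathbf{m}^{n-1}}{\Delta t}=-\beta\,\mathbf{m}^{n-1}\times\Delta_h\widetilde{\mathbf{m}}^n-\gamma\,\mathbf{m}^{n-1}\times(\mathbf{m}^{n-1}\times\Delta_h\widetilde{\mathbf{m}}^n),\qquad \mathbf{m}^n=\frac{\widetilde{\mathbf{m}}^n}{|\widetilde{\mathbf{m}}^n|}.$$ Then for every $1\le n\le N$, $$\frac12\|\nabla_h\mathbf{m}^n\|_2^2-\frac12\|\nabla_h\mathbf{m}^{n-1}\|_2^2\le-\gamma\Delta t\,\|\mathbf{m}^{n-1}\times\Delta_h\widetilde{\mathbf{m}}^n\|_2^2\le 0,$$ and consequently $$\frac12\|\nabla_h\mathbf{m}^n\|_2^2+\gamma\Delta t\sum_{k=1}^n\|\mathbf{m}^{k-1}\times\Delta_h\widetilde{\mathbf{m}}^k\|_2^2\le\frac12\|\nabla_h\mathbf{m}^0\|_2^2 .$$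
   Context: Grid: the domain is the unit cube $\Omega=(0,1)^3$ with a uniform mesh of size $h=1/M$, $M$ a positive integer, and periodic boundary conditions. Grid functions are maps $\boldsymbol f:\mathbf I\mapsto\boldsymbol f_{\mathbf I}\in\mathbb{R}^3$ defined for $\mathbf I=(i,j,k)$ with $0\le i,j,k\le M-1$ (this index set is $\mathcal T_h$), extended $M$-periodically in each index. With $\mathbf u_1,\mathbf u_2,\mathbf u_3$ the unit index vectors, $\nabla_h\boldsymbol f_{\mathbf I}$ is the $3\times3$ matrix whose $a$-th column is the difference quotient $(\boldsymbol f_{\mathbf I+\mathbf u_a}-\boldsymbol f_{\mathbf I})/h$, and $\Delta_h\boldsymbol f_{\mathbf I}=\sum_{a=1}^3(\boldsymbol f_{\mathbf I+\mathbf u_a}-2\boldsymbol f_{\mathbf I}+\boldsymbol f_{\mathbf I-\mathbf u_a})/h^2$. $|\cdot|$ is the Euclidean norm on $\mathbb{R}^3$, and $A:B$ is the sum of entrywise products of matrices. Norms: $\|\boldsymbol f\|_2^2=h^3\sum_{\mathbf I\in\mathcal T_h}|\boldsymbol f_{\mathbf I}|^2$ and $\|\nabla_h\boldsymbol f\|_2^2=h^3\sum_{\mathbf I\in\mathcal T_h}\nabla_h\boldsymbol f_{\mathbf I}:\nabla_h\boldsymbol f_{\mathbf I}$. Products, cross products and normalizations of grid functions are taken pointwise. *)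

(* Defs.v *)
From mathcomp Require Import all_boot all_order all_algebra.
From mathcomp Require Import reals.

Set Implicit Arguments.
Unset Strict Implicit.
Unset Printing Implicit Defensive.

Import Order.TTheory GRing.Theory Num.Theory.
Local Open Scope ring_scope.

(* The index set T_h = {0, ..., M-1}^3. *)
Notation gridIdx M := {ffun 'I_3 -> 'I_M}.

Notation gridFun R M := (gridIdx M -> 'cV[R]_3).

(* I + u_a and I - u_a reduced modulo M in each index (ordS and ord_pred are
   cyclic): f (idx_next a I) is the value at I + u_a of the M-periodic
   extension of f. *)
Definition idx_next (M : nat) (a : 'I_3) (I : gridIdx M) : gridIdx M :=
  [ffun b => if b == a then ordS (I b) else I b].

Definition idx_prev (M : nat) (a : 'I_3) (I : gridIdx M) : gridIdx M :=
  [ffun b => if b == a then ord_pred (I b) else I b].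

Section Vectors.
Variable R : realType.

Definition crossprod (u v : 'cV[R]_3) : 'cV[R]_3 :=
  \col_i [:: u 1 0 * v 2 0 - u 2 0 * v 1 0;
             u 2 0 * v 0 0 - u 0 0 * v 2 0;
             u 0 0 * v 1 0 - u 1 0 * v 0 0]`_i.

Definition enorm (u : 'cV[R]_3) : R := Num.sqrt (\sum_i u i 0 ^+ 2).

Definition ddot (A B : 'M[R]_3) : R := \sum_i \sum_j A i j * B i j.

End Vectors.

Section GridOperators.
Variables (R : realType) (M : nat).

Definition mesh : R := 1 / M%:R.

Definition grad_h (f : gridFun R M) (I : gridIdx M) : 'M[R]_3 :=
  \matrix_(b, a) ((f (idx_next a I) - f I) b 0 / mesh).

Definition laplace_h (f : gridFun R M) (I : gridIdx M) : 'cV[R]_3 :=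
  \sum_a mesh ^- 2 *: (f (idx_next a I) - 2 *: f I + f (idx_prev a I)).

Definition l2norm (f : gridFun R M) : R :=
  Num.sqrt (mesh ^+ 3 * \sum_I enorm (f I) ^+ 2).

Definition l2norm_mx (A : gridIdx M -> 'M[R]_3) : R :=
  Num.sqrt (mesh ^+ 3 * \sum_I ddot (A I) (A I)).

Definition gcross (f g : gridFun R M) : gridFun R M :=
  fun I => crossprod (f I) (g I).

End GridOperators.

(* Main.v *)
Require Import Defs.
From mathcomp Require Import all_boot all_order all_algebra.
From mathcomp Require Import reals.
From mathcomp Require Import ring lra.

Import Order.TTheory GRing.Theory Num.Theory.
Local Open Scope ring_scope.

(** A step of the scheme moves [m] by a vector [mt I - m I] orthogonal to
    [m I], so Pythagoras gives [|mt I| >= |m I| = 1] at every node.  The radial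
    projection onto the unit sphere does not increase distances outside the open
    unit ball ([dot_normalize_le]), hence normalizing [mt] cannot increase the
    norm of the discrete gradient, which only involves differences of values at
    neighbouring nodes.

    It remains to bound the Dirichlet energy of [mt].  Testing the scheme with
    [- laplace_h mt] and summing by parts on the periodic grid
    ([sum_ddot_grad]), the beta-term vanishes since [m x L] is orthogonal to
    [L], while the gamma-term yields exactly the dissipation [|m x L|^2]; the
    convexity inequality [|q|^2 - |p|^2 <= 2 q . (q - p)], applied to the
    gradients, turns this identity into the decrease of energy.  The summed
    estimate telescopes. *)

(** * The Euclidean inner product on three-dimensional column vectors *)

(** The inner product underlying [enorm]. *)
Definition dot {R : realType} (u v : 'cV[R]_3) : R := \sum_i u i 0 * v i 0.

Lemma dotE {R : realType} (u v : 'cV[R]_3) :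
  dot u v = u 0 0 * v 0 0 + u 1 0 * v 1 0 + u 2 0 * v 2 0.
Proof.
rewrite /dot !big_ord_recl big_ord0 addr0 addrA.
by congr (_ + _ * _ + _ * _); congr (_ _ _); apply: val_inj.
Qed.

Lemma dotC {R : realType} (u v : 'cV[R]_3) : dot u v = dot v u.
Proof. by rewrite !dotE; ring. Qed.

Lemma dotDl {R : realType} (u v w : 'cV[R]_3) :
  dot (u + v) w = dot u w + dot v w.
Proof. by rewrite !dotE !mxE; ring. Qed.

Lemma dotZl {R : realType} (c : R) (u v : 'cV[R]_3) :
  dot (c *: u) v = c * dot u v.
Proof. by rewrite !dotE !mxE; ring. Qed.

Lemma dotNl {R : realType} (u v : 'cV[R]_3) : dot (- u) v = - dot u v.
Proof. by rewrite !dotE !mxE; ring. Qed.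

Lemma dotDr {R : realType} (u v w : 'cV[R]_3) :
  dot u (v + w) = dot u v + dot u w.
Proof. by rewrite dotC dotDl !(dotC u). Qed.

Lemma dotZr {R : realType} (c : R) (u v : 'cV[R]_3) :
  dot u (c *: v) = c * dot u v.
Proof. by rewrite dotC dotZl (dotC u). Qed.

Lemma dotNr {R : realType} (u v : 'cV[R]_3) : dot u (- v) = - dot u v.
Proof. by rewrite dotC dotNl (dotC u). Qed.

Lemma dot_suml {R : realType} (T : finType) (F : T -> 'cV[R]_3)
    (v : 'cV[R]_3) :
  dot (\sum_t F t) v = \sum_t dot (F t) v.
Proof.
rewrite /dot exchange_big; apply: eq_bigr => i _ /=.
by rewrite summxE mulr_suml.
Qed.

Lemma dot_ge0 {R : realType} (u : 'cV[R]_3) : 0 <= dot u u.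
Proof. by apply: sumr_ge0 => i _; rewrite -expr2 sqr_ge0. Qed.

Lemma enorm_ge0 {R : realType} (u : 'cV[R]_3) : 0 <= enorm u.
Proof. exact: sqrtr_ge0. Qed.

Lemma enorm_sqr {R : realType} (u : 'cV[R]_3) : enorm u ^+ 2 = dot u u.
Proof.
rewrite sqr_sqrtr; last by apply: sumr_ge0 => i _; rewrite sqr_ge0.
by apply: eq_bigr => i _; rewrite expr2.
Qed.

Lemma enorm_normalize {R : realType} (u : 'cV[R]_3) :
  1 <= enorm u -> enorm ((enorm u)^-1 *: u) = 1.
Proof.
move=> hu; apply/eqP.
rewrite -(@eqrXn2 _ 2) ?enorm_ge0 ?ler01 //.
rewrite enorm_sqr dotZl dotZr -enorm_sqr expr1n; apply/eqP; field.
by lra.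
Qed.

(** The convexity inequality for the squared norm. *)
Lemma dot_sub_le {R : realType} (p q : 'cV[R]_3) :
  dot q q - dot p p <= 2 * dot q (q - p).
Proof.
have := dot_ge0 (q - p).
by rewrite !(dotDl, dotDr, dotNl, dotNr) (dotC p q); lra.
Qed.

Lemma dot_le_enorm {R : realType} (u v : 'cV[R]_3) :
  0 < enorm u -> 0 < enorm v -> dot u v <= enorm u * enorm v.
Proof.
move=> hu hv; have uv0 : 0 < enorm u * enorm v by rewrite mulr_gt0.
have := dot_ge0 (enorm v *: u - enorm u *: v).
rewrite !(dotDl, dotDr, dotNl, dotNr, dotZl, dotZr) (dotC v u) -!enorm_sqr.
move=> h; rewrite -(ler_pM2l uv0); move: h; nra.
Qed.

(** The projection onto the unit sphere is 1-Lipschitz outside the open unit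
    ball. *)
Lemma dot_normalize_le {R : realType} (u v : 'cV[R]_3) :
  1 <= enorm u -> 1 <= enorm v ->
  let d := (enorm u)^-1 *: u - (enorm v)^-1 *: v in
  dot d d <= dot (u - v) (u - v).
Proof.
move=> hu hv /=.
have hc : dot u v <= enorm u * enorm v by apply: dot_le_enorm; lra.
rewrite !(dotDl, dotDr, dotNl, dotNr, dotZl, dotZr) (dotC v u) -!enorm_sqr.
move: (enorm u) (enorm v) (dot u v) hu hv hc => p q c hp hq hc.
have pq1 : 1 <= p * q by rewrite mulr_ege1.
have r1 : (p * q)^-1 <= 1 by rewrite invf_le1 //; lra.
have hr : (p * q) * (p * q)^-1 = 1 by rewrite divff //; lra.
have -> : p^-1 * (p^-1 * p ^+ 2) - p^-1 * (q^-1 * c) +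
    (- (q^-1 * (p^-1 * c)) - - (q^-1 * (q^-1 * q ^+ 2)))
    = 2 - 2 * (c * (p * q)^-1).
  by field; rewrite !gt_eqF //; lra.
move: ((p * q)^-1) r1 hr => r r1 hr.
(* The gap [p^2 + q^2 - 2 - 2 c (1 - r)] is nonincreasing in [c], because
   [r <= 1], and at the upper bound [c = p * q] it equals [(p - q)^2]. *)
have h1 : 0 <= (p * q - c) * (1 - r) by rewrite mulr_ge0 // subr_ge0.
have h2 := sqr_ge0 (p - q).
have h3 : (p * q - c) * (1 - r) = p * q - 1 - c + c * r.
  by rewrite -[in RHS]hr; ring.
have h4 : (p - q) ^+ 2 = p ^+ 2 - 2 * (p * q) + q ^+ 2 by ring.
lra.
Qed.

(** * Cross products *)

Lemma crossprodE {R : realType} (u v : 'cV[R]_3) :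
  ((crossprod u v 0 0 = u 1 0 * v 2 0 - u 2 0 * v 1 0) *
   (crossprod u v 1 0 = u 2 0 * v 0 0 - u 0 0 * v 2 0) *
   (crossprod u v 2 0 = u 0 0 * v 1 0 - u 1 0 * v 0 0))%type.
Proof. by rewrite !mxE. Qed.

Lemma dot_cross_l {R : realType} (u v : 'cV[R]_3) : dot u (crossprod u v) = 0.
Proof. by rewrite dotE !crossprodE; ring. Qed.

Lemma dot_cross_r {R : realType} (u v : 'cV[R]_3) : dot v (crossprod u v) = 0.
Proof. by rewrite dotE !crossprodE; ring. Qed.

Lemma dot_cross_cross {R : realType} (u v : 'cV[R]_3) :
  dot v (crossprod u (crossprod u v)) = - dot (crossprod u v) (crossprod u v).
Proof. by rewrite !dotE !crossprodE; ring. Qed.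

(** * Summation by parts on the periodic grid *)

Lemma idx_nextK (M : nat) (a : 'I_3) :
  cancel (@idx_next M a) (@idx_prev M a).
Proof.
by move=> I; apply/ffunP => b; rewrite !ffunE; case: eqP => // _; rewrite ordSK.
Qed.

Lemma idx_prevK (M : nat) (a : 'I_3) :
  cancel (@idx_prev M a) (@idx_next M a).
Proof.
move=> I; apply/ffunP => b; rewrite !ffunE.
by case: eqP => // _; rewrite ord_predK.
Qed.

Lemma mesh_gt0 (R : realType) (M : nat) : (0 < M)%N -> 0 < mesh R M.
Proof. by move=> hM; rewrite divr_gt0 ?ltr01 ?ltr0n. Qed.

Lemma ddot_grad {R : realType} {M : nat} (f g : gridFun R M) (I : gridIdx M) :
  ddot (grad_h f I) (grad_h g I) =
  mesh R M ^- 2 *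
    \sum_a dot (f (idx_next a I) - f I) (g (idx_next a I) - g I).
Proof.
rewrite /ddot exchange_big mulr_sumr /=; apply: eq_bigr => a _.
rewrite /dot mulr_sumr; apply: eq_bigr => b _; rewrite !mxE -exprVn.
by rewrite expr2 mulrACA mulrC.
Qed.

(** The discrete Green identity; periodicity leaves no boundary term. *)
Lemma sum_ddot_grad {R : realType} {M : nat} (f g : gridFun R M) :
  \sum_I ddot (grad_h f I) (grad_h g I) = - \sum_I dot (laplace_h f I) (g I).
Proof.
under eq_bigr do rewrite ddot_grad.
rewrite -mulr_sumr exchange_big /=.
under [in RHS]eq_bigr do rewrite /laplace_h -scaler_sumr dotZl dot_suml.
rewrite -mulr_sumr -mulrN [in RHS]exchange_big -sumrN /=; congr (_ * _).
apply: eq_bigr => a _.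
under eq_bigr do rewrite dotDr dotNr.
rewrite big_split sumrN /=.
(* Shift the sum over I of [(f (I + u_a) - f I) . g (I + u_a)] by one node. *)
rewrite (reindex (@idx_prev M a)) /=; last first.
  by exists (@idx_next M a) => I _; rewrite (idx_prevK, idx_nextK).
rewrite -!sumrN -big_split /=; apply: eq_bigr => I _.
by rewrite idx_prevK !(dotDl, dotNl, dotZl); ring.
Qed.

Lemma ddot_ge0 {R : realType} (A : 'M[R]_3) : 0 <= ddot A A.
Proof.
by apply: sumr_ge0 => i _; apply: sumr_ge0 => j _; rewrite -expr2 sqr_ge0.
Qed.

Lemma l2norm_sqr {R : realType} {M : nat} (f : gridFun R M) :
  (0 < M)%N -> l2norm f ^+ 2 = mesh R M ^+ 3 * \sum_I dot (f I) (f I).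
Proof.
move=> hM; rewrite sqr_sqrtr; last first.
  rewrite mulr_ge0 ?exprn_ge0 ?(ltW (mesh_gt0 R M hM)) //.
  by apply: sumr_ge0 => I _; rewrite sqr_ge0.
by under eq_bigr do rewrite enorm_sqr.
Qed.

Lemma l2norm_mx_sqr {R : realType} {M : nat} (A : gridIdx M -> 'M[R]_3) :
  (0 < M)%N -> l2norm_mx A ^+ 2 = mesh R M ^+ 3 * \sum_I ddot (A I) (A I).
Proof.
move=> hM; rewrite sqr_sqrtr // mulr_ge0 //.
  by rewrite exprn_ge0 // ltW ?mesh_gt0.
by apply: sumr_ge0 => I _; exact: ddot_ge0.
Qed.

(** The Dirichlet energy is convex and, by the Green identity, its gradient at
    [g] is [- laplace_h g] up to scaling. *)
Lemma sum_ddot_grad_sub_le {R : realType} {M : nat} (f g : gridFun R M) :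
  (0 < M)%N ->
  \sum_I ddot (grad_h g I) (grad_h g I) - \sum_I ddot (grad_h f I) (grad_h f I)
    <= - 2 * \sum_I dot (laplace_h g I) (g I - f I).
Proof.
move=> hM.
rewrite mulNr -mulrN -(sum_ddot_grad g (fun I => g I - f I)) mulr_sumr -sumrB.
apply: ler_sum => I _; rewrite !ddot_grad -mulrBr mulrCA.
rewrite ler_pM2l ?invr_gt0 ?exprn_gt0 ?mesh_gt0 //.
rewrite -sumrB mulr_sumr; apply: ler_sum => a _.
have -> : g (idx_next a I) - f (idx_next a I) - (g I - f I) =
    (g (idx_next a I) - g I) - (f (idx_next a I) - f I).
  by rewrite !opprB addrACA [RHS]addrACA; congr (_ + _); rewrite addrC.
exact: dot_sub_le.
Qed.

(** * One step of the scheme *)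

(** A tangential increment does not decrease the length. *)
Lemma enorm_ge1_of_orthogonal {R : realType} (u v : 'cV[R]_3) :
  enorm u = 1 -> dot u (v - u) = 0 -> 1 <= enorm v.
Proof.
move=> hu huv; rewrite -(@ler_pXn2r _ 2) ?nnegrE ?ler01 ?enorm_ge0 //.
rewrite expr1n enorm_sqr.
have := dot_ge0 (v - u); have := enorm_sqr u; rewrite hu expr1n.
by move: huv; rewrite !(dotDl, dotDr, dotNl, dotNr) (dotC v u); lra.
Qed.

(** The pointwise content of the scheme, with [L] standing for the Laplacian:
    the increment is tangential, and testing it with [L] leaves only the damping
    term. *)
Lemma step_increment {R : realType} (dt beta gamma : R) (u v L : 'cV[R]_3) :
  0 < dt ->
  dt^-1 *: (v - u) = - (beta *: crossprod u L)
                     - gamma *: crossprod u (crossprod u L) ->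
  dot u (v - u) = 0 /\
  dot L (v - u) = gamma * dt * dot (crossprod u L) (crossprod u L).
Proof.
move=> hdt h.
have -> : v - u = dt *: (dt^-1 *: (v - u)).
  by rewrite scalerA divff ?scale1r // gt_eqF.
rewrite h !(dotDr, dotNr, dotZr) !dot_cross_l dot_cross_r dot_cross_cross.
by split; ring.
Qed.

(** Normalizing a grid function with values outside the open unit ball does not
    increase its Dirichlet energy. *)
Lemma sum_ddot_grad_normalize {R : realType} {M : nat} (f g : gridFun R M) :
  (0 < M)%N -> (forall I, 1 <= enorm (f I)) ->
  (forall I, g I = (enorm (f I))^-1 *: f I) ->
  \sum_I ddot (grad_h g I) (grad_h g I) <= \sum_I ddot (grad_h f I) (grad_h f I).
Proof.
move=> hM hf hg; apply: ler_sum => I _; rewrite !ddot_grad.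
rewrite ler_pM2l ?invr_gt0 ?exprn_gt0 ?mesh_gt0 //.
by apply: ler_sum => a _; rewrite !hg; exact: dot_normalize_le.
Qed.

(** The unit-length constraint is part of the conclusion because it is the
    hypothesis needed at the following step. *)
Lemma step_energy {R : realType} {M : nat} (dt beta gamma : R)
    (m0 mt m1 : gridFun R M) :
  (0 < M)%N -> 0 < dt -> (forall I, enorm (m0 I) = 1) ->
  (forall I, dt^-1 *: (mt I - m0 I) =
       - (beta *: crossprod (m0 I) (laplace_h mt I))
       - gamma *: crossprod (m0 I) (crossprod (m0 I) (laplace_h mt I))) ->
  (forall I, m1 I = (enorm (mt I))^-1 *: mt I) ->
  (forall I, enorm (m1 I) = 1) /\
  1 / 2 * l2norm_mx (grad_h m1) ^+ 2 - 1 / 2 * l2norm_mx (grad_h m0) ^+ 2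
    <= - gamma * dt * l2norm (gcross m0 (laplace_h mt)) ^+ 2.
Proof.
move=> hM hdt h0 hs h1.
have hinc I := step_increment _ _ _ _ _ _ hdt (hs I).
have hmt I : 1 <= enorm (mt I).
  by apply: enorm_ge1_of_orthogonal (h0 I) _; case: (hinc I).
split=> [I|]; first by rewrite h1 enorm_normalize.
have hproj := sum_ddot_grad_normalize _ _ hM hmt h1.
have henergy := sum_ddot_grad_sub_le m0 mt hM.
rewrite !l2norm_mx_sqr // l2norm_sqr //.
have hdiss : \sum_I dot (laplace_h mt I) (mt I - m0 I) =
    gamma * dt * \sum_I dot (gcross m0 (laplace_h mt) I)
                            (gcross m0 (laplace_h mt) I).
  by rewrite mulr_sumr; apply: eq_bigr => I _; case: (hinc I).
rewrite hdiss in henergy.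
have : 0 <= mesh R M ^+ 3 by rewrite exprn_ge0 // ltW ?mesh_gt0.
move: (mesh R M ^+ 3) (\sum_I ddot (grad_h m1 I) _) hproj henergy => h3 E1.
move: (\sum_I ddot (grad_h mt I) _) (\sum_I ddot (grad_h m0 I) _) => Et E0.
move: (\sum_I _) => D hproj henergy h3_ge0.
have h : 0 <= h3 * (1 / 2 * E0 - 1 / 2 * E1 - gamma * dt * D).
  by rewrite mulr_ge0 //; lra.
by move: h; lra.
Qed.

Theorem theorem3p4 (R : realType) (M : nat) (hM : (0 < M)%N)
  (gamma beta dt : R) (hgamma : 0 < gamma) (hdt : 0 < dt)
  (N : nat) (hN : (1 <= N)%N)
  (m mt : nat -> gridFun R M)
  (hm0 : forall I, enorm (m 0%N I) = 1)
  (hscheme : forall n, (1 <= n <= N)%N -> forall I,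
     dt^-1 *: (mt n I - m n.-1 I) =
       - (beta *: crossprod (m n.-1 I) (laplace_h (mt n) I))
       - gamma *: crossprod (m n.-1 I)
                    (crossprod (m n.-1 I) (laplace_h (mt n) I)))
  (hproj : forall n, (1 <= n <= N)%N -> forall I,
     m n I = (enorm (mt n I))^-1 *: mt n I) :
  forall n, (1 <= n <= N)%N ->
  [/\ 1 / 2 * l2norm_mx (grad_h (m n)) ^+ 2
        - 1 / 2 * l2norm_mx (grad_h (m n.-1)) ^+ 2
      <= - gamma * dt * l2norm (gcross (m n.-1) (laplace_h (mt n))) ^+ 2,
      - gamma * dt * l2norm (gcross (m n.-1) (laplace_h (mt n))) ^+ 2 <= 0
    & 1 / 2 * l2norm_mx (grad_h (m n)) ^+ 2
        + gamma * dt *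
          \sum_(1 <= k < n.+1)
             l2norm (gcross (m k.-1) (laplace_h (mt k))) ^+ 2
      <= 1 / 2 * l2norm_mx (grad_h (m 0%N)) ^+ 2].
Proof.
have hunit n : (n <= N)%N -> forall I, enorm (m n I) = 1.
  elim: n => [//|n IHn] hn.
  have hn' : (1 <= n.+1 <= N)%N by [].
  by have [] := step_energy _ _ _ _ _ _ hM hdt (IHn (ltnW hn))
                  (hscheme _ hn') (hproj _ hn').
have hdecr n : (1 <= n <= N)%N ->
    1 / 2 * l2norm_mx (grad_h (m n)) ^+ 2
      - 1 / 2 * l2norm_mx (grad_h (m n.-1)) ^+ 2
    <= - gamma * dt * l2norm (gcross (m n.-1) (laplace_h (mt n))) ^+ 2.
  move=> hn; have hn1 : (n.-1 <= N)%N.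
    by case/andP: hn => _; apply: leq_trans; exact: leq_pred.
  by have [] := step_energy _ _ _ _ _ _ hM hdt (hunit _ hn1)
                  (hscheme _ hn) (hproj _ hn).
move=> n hn; split; first exact: hdecr.
  by rewrite !mulNr oppr_le0 mulr_ge0 ?sqr_ge0 // ltW ?mulr_gt0.
have {hn} : (n <= N)%N by case/andP: hn.
elim: n => [_|n IHn hn]; first by rewrite big_geq // mulr0 addr0.
have hn' : (1 <= n.+1 <= N)%N by [].
rewrite big_nat_recr //= mulrDr.
by have := hdecr _ hn'; have := IHn (ltnW hn); rewrite /= !mulNr; lra.
Qed.
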